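(* Let $z$ be a complex number with $|z|<1$. Then $$\prod_{\substack{m,n \geq 1 \\ m \leq n,\ \gcd(m,n)=1}} \left( \frac{1}{1-z^n} \right)^{\frac{m}{n^2}} = \sqrt{\frac{1}{1-z}}\; \exp\left\{ \frac{1}{2}\,\frac{z}{1-z} \right\},$$ and $$\prod_{\substack{m,n \geq 1 \\ m \leq n,\ \gcd(m,n)=1}} \left(1-z^n\right)^{\frac{m}{n^2}} = \sqrt{1-z}\; \exp\left\{ -\frac{1}{2}\,\frac{z}{1-z} \right\}.$$
   Context: The products run over all pairs of positive integers $(m,n)$ with $m\le n$ and $\gcd(m,n)=1$. Complex powers are taken with the principal branch, i.e. $(1-w)^{\alpha}=\exp(\alpha\log(1-w))$ with the principal logarithm, for $|w|<1$. *)

(* Defs.v *)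
From HB Require Import structures.
From mathcomp Require Import all_boot all_order all_algebra finmap complex.
From mathcomp Require Import all_classical all_reals all_analysis.
From mathcomp.analysis.showcase Require Import summability.
Set Implicit Arguments.
Unset Strict Implicit.
Unset Printing Implicit Defensive.
Import Order.TTheory GRing.Theory Num.Theory.
Import numFieldNormedType.Exports.
Local Open Scope classical_set_scope.
Local Open Scope ring_scope.
Local Open Scope complex_scope.

Definition cexp (R : realType) (z : R[i]) : R[i] :=
  (expR (complex.Re z))%:C * (cos (complex.Im z) +i* sin (complex.Im z)).

(* Principal argument of w != 0: it exceeds -pi and is at most pi, so that a
   negative real has argument pi. *)
Definition carg (R : realType) (w : R[i]) : R :=
  let t := acos (complex.Re w / Normc.normc w) in
  if 0 <= complex.Im w then t else - t.

(* Principal logarithm of w != 0; the value at 0 is junk. *)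
Definition clog (R : realType) (w : R[i]) : R[i] :=
  ln (Normc.normc w) +i* carg w.

(* Principal branch, for w != 0. *)
Definition cpow (R : realType) (w a : R[i]) : R[i] := cexp (a * clog w).

(* Num.sqrt is restricted to real numbers and sqrtC returns the root with
   nonnegative imaginary part, which is not the principal one. *)
Definition csqrt (R : realType) (w : R[i]) : R[i] := cpow w 2^-1.

#[global] Existing Instance totally_filter.

(* The product of the f i over all i satisfying P converges unconditionally to
   l: the finite partial products converge to l along the finite sets of
   indices directed by inclusion. The regular module R[i]^o carries the
   topology of the modulus. *)
Definition prod_cvg (R : realType) (I : choiceType) (P : pred I)
    (f : I -> R[i]) (l : R[i]) : Prop :=
  (fun F : {fset I} => \prod_(i <- F | P i) f i : R[i]^o) @ totally
    --> (l : R[i]^o).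

(* The argument is (m, n), in this order. *)
Definition coprime_pair (p : nat * nat) : bool :=
  [&& (1 <= p.1)%N, (1 <= p.2)%N, (p.1 <= p.2)%N & coprime p.1 p.2].

(* Main.v *)
(* Put l n = clog (1 - z^n).  Expanding l in powers of z^n, the coefficient of
   z^M in the sum of - (m / n^2) l n over coprime pairs m <= n is 1/M times the
   sum of m/n over the coprime pairs with n | M.  Every fraction j/M with
   1 <= j <= M is exactly one such m/n in lowest terms, so this coefficient is
   (M + 1) / (2 M), which gives - clog (1 - z) / 2 + z / (2 (1 - z)).  To avoid
   double series, each logarithm with n <= N is truncated at order N/n, so that
   only powers z^M with M <= N occur and the remainders are O(|z|^(N+1)). *)
Require Import Defs.
From HB Require Import structures.
From mathcomp Require Import all_boot all_order all_algebra finmap complex.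
From mathcomp Require Import all_classical all_reals all_analysis.
From mathcomp.analysis.showcase Require Import summability.
From mathcomp Require Import ring lra zify.
Set Implicit Arguments.
Unset Strict Implicit.
Unset Printing Implicit Defensive.
Import Order.TTheory GRing.Theory Num.Theory.
Import numFieldNormedType.Exports.
Local Open Scope classical_set_scope.
Local Open Scope ring_scope.
Local Open Scope complex_scope.

(** * Real-valued modulus on the complex numbers *)

Section ComplexModulus.
Variable R : realType.
Implicit Types x y z : R[i].
Local Notation normc := Normc.normc.

Lemma normc_addr x y : normc (x + y) <= normc x + normc y.
Proof. exact: le_normcD. Qed.

Lemma normc_oppr x : normc (- x) = normc x.
Proof. exact: normcN. Qed.

Lemma normc_ge0 x : 0 <= normc x.
Proof. by case: x => a b; rewrite /normc sqrtr_ge0. Qed.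

Lemma normcX x n : normc (x ^+ n) = normc x ^+ n.
Proof.
by elim: n => [|n IH]; rewrite ?expr0 ?Normc.normc1 // !exprS Normc.normcM IH.
Qed.

Lemma normc_sum (I : Type) (s : seq I) (P : pred I) (f : I -> R[i]) :
  normc (\sum_(i <- s | P i) f i) <= \sum_(i <- s | P i) normc (f i).
Proof.
elim/big_rec2: _ => [|i y1 y2 _ le12]; first by rewrite Normc.normc0.
by rewrite (le_trans (normc_addr _ _))// lerD2l.
Qed.

Lemma normc_real (a : R) : normc a%:C = `|a|.
Proof. by rewrite /normc /= expr0n addr0 sqrtr_sqr. Qed.

Lemma normcRe_le x : `|complex.Re x| <= normc x.
Proof.
case: x => a b; rewrite -sqrtr_sqr /normc /= ler_sqrt ?lerDl ?sqr_ge0//.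
by rewrite addr_ge0 ?sqr_ge0.
Qed.

Lemma normcIm_le x : `|complex.Im x| <= normc x.
Proof.
case: x => a b; rewrite -sqrtr_sqr /normc /= ler_sqrt ?lerDr ?sqr_ge0//.
by rewrite addr_ge0 ?sqr_ge0.
Qed.

Lemma normc_le_ReIm x : normc x <= `|complex.Re x| + `|complex.Im x|.
Proof.
case: x => a b; rewrite /normc /=.
rewrite -(ger0_norm (addr_ge0 (normr_ge0 a) (normr_ge0 b))) -sqrtr_sqr.
rewrite ler_sqrt ?sqr_ge0// sqrrD !real_normK ?num_real//.
by rewrite lerD2r lerDl mulrn_wge0 ?mulr_ge0.
Qed.

Lemma normcrE x : `|x| = (normc x)%:C.
Proof. by case: x. Qed.

Lemma one_subr_neq0 x : normc x < 1 -> 1 - x != 0.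
Proof.
by move=> x1; apply: contraTneq x1 => /subr0_eq <-; rewrite Normc.normc1 ltxx.
Qed.

Lemma normc_one_subr x : 1 - normc x <= normc (1 - x).
Proof.
rewrite lerBlDr -{1}(Normc.normc1 R) -{1}(subrK x 1); exact: normc_addr.
Qed.

End ComplexModulus.

(** * Principal logarithm on the open right half-plane *)

Section Clog.
Variable R : realType.
Implicit Types u w : R[i].

(** The argument lies in (-pi/2, pi/2) here, where the signed [acos] agrees with [atan]; this form
    can be differentiated without a case split. *)
Lemma clogE u : 0 < complex.Re u ->
  clog u = (ln (complex.Re u ^+ 2 + complex.Im u ^+ 2) / 2)
    +i* atan (complex.Im u / complex.Re u).
Proof.
case: u => a b /= a0; rewrite /clog /carg /=.
have D0 : 0 < a ^+ 2 + b ^+ 2 by rewrite ltr_wpDr ?sqr_ge0 ?exprn_gt0.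
have sD0 : 0 < Num.sqrt (a ^+ 2 + b ^+ 2) by rewrite sqrtr_gt0.
congr (_ +i* _).
  by rewrite -[in RHS](sqr_sqrtr (ltW D0)) lnXn//; field.
have cE : a / Num.sqrt (a ^+ 2 + b ^+ 2) = cos (atan (b / a)).
  rewrite cos_atan.
  have -> : 1 + (b / a) ^+ 2 = (a ^+ 2 + b ^+ 2) / a ^+ 2.
    by field; rewrite gt_eqF.
  rewrite sqrtrM ?ltW// sqrtrV ?sqr_ge0// sqrtr_sqr gtr0_norm//.
  by rewrite invfM invrK mulrC.
have [lo hi] := (atan_gtNpi2 (b / a), atan_ltpi2 (b / a)).
have p0 := @pi_gt0 R.
(* [acos] inverts [cos] only on [0, pi]; for [b < 0] it returns the opposite angle, which the sign
   in [carg] corrects. *)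
rewrite cE; case: ifPn => [b0|]; last rewrite -ltNge => b0.
  rewrite cosK// in_itv/=; apply/andP; split; last by lra.
  by rewrite -(@atan0 R) le_atan// divr_ge0// ltW.
have t0 : atan (b / a) < 0.
  by rewrite -(@atan0 R) lt_atan// pmulr_llt0// invr_gt0.
by rewrite cosKN ?opprK//; apply/andP; split; lra.
Qed.

(** Inversion negates the logarithm of the modulus, and [atan] is odd. On the negative real axis the
    identity fails, since [u] and [1 / u] both have argument pi. *)
Lemma clogV u : 0 < complex.Re u -> clog (1 / u) = - clog u.
Proof.
move=> u0; have := u0; rewrite div1r; case: u u0 => a b /= a0 _.
have D0 : 0 < a ^+ 2 + b ^+ 2 by rewrite ltr_wpDr ?sqr_ge0 ?exprn_gt0.
have VE : (a +i* b)^-1 = (a / (a ^+ 2 + b ^+ 2)) +i* (- b / (a ^+ 2 + b ^+ 2)).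
  by rewrite mulNr.
rewrite VE !clogE//=; last by rewrite divr_gt0.
have a0' : a != 0 by rewrite gt_eqF.
have D0' : a ^+ 2 + b ^+ 2 != 0 by rewrite gt_eqF.
apply/eqP; rewrite eq_complex/=; apply/andP; split; apply/eqP.
  have -> : (a / (a ^+ 2 + b ^+ 2)) ^+ 2 + (- b / (a ^+ 2 + b ^+ 2)) ^+ 2 =
     (a ^+ 2 + b ^+ 2)^-1 by field.
  by rewrite lnV// mulNr.
rewrite -atanN; congr atan; by field; rewrite a0'.
Qed.

End Clog.

(** * Truncated series of log(1 - w) with remainder *)

Section LogSeries.
Variable R : realType.
Implicit Types (w : R[i]) (t : R).
Local Notation normc := Normc.normc.

(** Serves twice, with [c k] the real and then the imaginary part of w^(k+1). *)
Lemma is_derive_trunc_pseries (c : nat -> R) K t :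
  is_derive t (1 : R) (fun s : R => \sum_(k < K) c k / k.+1%:R * s ^+ k.+1)
    (\sum_(k < K) c k * t ^+ k).
Proof.
have -> : (fun s : R => \sum_(k < K) c k / k.+1%:R * s ^+ k.+1) =
    \sum_(k < K) (fun s : R => c k / k.+1%:R * s ^+ k.+1).
  by apply/funext => s; rewrite fct_sumE.
apply: is_derive_sum => k.
have := is_deriveZ (c k / k.+1%:R) (is_deriveX k.+1 (is_derive_id t (1 : R))).
rewrite (_ : _ \*: _ = (fun s : R => c k / k.+1%:R * s ^+ k.+1)); last first.
  by apply/funext => s; rewrite /= !fctE.
move=> H; apply: (is_derive_eq H) => /=.
by rewrite /GRing.scale/= mulr1 mulrA divfK.
Qed.

Lemma is_derive_opp_mul (y t : R) :
  is_derive t (1 : R) (fun s : R => - (s * y)) (- y).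
Proof.
have -> : (fun s : R => - (s * y)) = (- (y \*: id)).
  by apply/funext => s; rewrite /= !fctE /GRing.scale /= mulrC.
apply: is_derive_eq; rewrite /GRing.scale /=; by ring.
Qed.

Lemma is_derive_one_sub_mul (x t : R) :
  is_derive t (1 : R) (fun s : R => 1 - s * x) (- x).
Proof.
have -> : (fun s : R => 1 - s * x) = cst 1 + (fun s : R => - (s * x)) by [].
have d := is_deriveD (is_derive_cst (1 : R) t (1 : R)) (is_derive_opp_mul x t).
by apply: (is_derive_eq d); rewrite add0r.
Qed.

(** With w = x + iy, the function is the real part of clog(1 - s w) in the form of [clogE], and the
    derivative is the real part of - w / (1 - t w). The imaginary parts are in
    [is_derive_atan_ray]. *)
Lemma is_derive_ln_ray (x y t : R) : 0 < 1 - t * x ->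
  is_derive t (1 : R) (fun s : R => ln ((1 - s * x) ^+ 2 + (- (s * y)) ^+ 2) / 2)
   (- (x * (1 - t * x) - t * y ^+ 2) / ((1 - t * x) ^+ 2 + (t * y) ^+ 2)).
Proof.
move=> h.
have D0 : 0 < (1 - t * x) ^+ 2 + (- (t * y)) ^+ 2.
  by rewrite ltr_wpDr ?sqr_ge0 ?exprn_gt0.
have da := is_derive_one_sub_mul x t.
have db := is_derive_opp_mul y t.
have dD := is_deriveD (is_deriveX 2 da) (is_deriveX 2 db).
have dl := @is_derive1_comp _ (@ln R) _ t _ _ (is_derive1_ln D0) dD.
have dh := is_deriveZ (2^-1) dl.
have -> : (fun s : R => ln ((1 - s * x) ^+ 2 + (- (s * y)) ^+ 2) / 2) =
   2^-1 \*: (ln (R:=R) \o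
     ((fun s : R => 1 - s * x) ^+ 2 + (fun s : R => - (s * y)) ^+ 2)).
  by apply/funext => s; rewrite /= !fctE /GRing.scale /= mulrC.
apply: (is_derive_eq dh); rewrite /GRing.scale /= !expr1.
rewrite sqrrN in D0 *.
by field; rewrite gt_eqF.
Qed.

Lemma is_derive_atan_ray (x y t : R) : 0 < 1 - t * x ->
  is_derive t (1 : R) (fun s : R => atan (- (s * y) / (1 - s * x)))
   (- y / ((1 - t * x) ^+ 2 + (t * y) ^+ 2)).
Proof.
move=> h.
have h0 : 1 - t * x != 0 by rewrite gt_eqF.
have D0 : (1 - t * x) ^+ 2 + (t * y) ^+ 2 != 0.
  by rewrite gt_eqF// ltr_wpDr ?sqr_ge0 ?exprn_gt0.
have da := is_derive_one_sub_mul x t.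
have db := is_derive_opp_mul y t.
have dq := is_deriveM db (@is_deriveV _ (fun s : R => 1 - s * x) t _ _ h0 da).
have dl := @is_derive1_comp _ (@atan R) _ t _ _ (is_derive1_atan _) dq.
apply: (is_derive_eq dl); rewrite /GRing.scale /=.
rewrite !fctE.
by field; rewrite D0 h0.
Qed.

Lemma le_mean_value (f df : R -> R) (B : R) : f 0 = 0 ->
  (forall t, 0 <= t <= 1 -> is_derive t (1 : R) f (df t)) ->
  (forall t, 0 <= t <= 1 -> `|df t| <= B) -> `|f 1| <= B.
Proof.
move=> f0 fd fB.
have [|||c] := @MVT_segment R f df 0 1; first exact: ler01.
- move=> t; rewrite in_itv/= => /andP[t0 t1]; apply: fd.
  by rewrite !ltW.
- apply: derivable_within_continuous => t; rewrite in_itv/= => t01.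
  by have [] := fd t t01.
- rewrite in_itv/= f0 !subr0 mulr1 => c01 ->; exact: fB.
Qed.

Lemma ReMr (z : R[i]) (a : R) : complex.Re (z * a%:C) = complex.Re z * a.
Proof. by case: z => u v /=; rewrite mulr0 subr0. Qed.

Lemma ImMr (z : R[i]) (a : R) : complex.Im (z * a%:C) = complex.Im z * a.
Proof. by case: z => u v /=; rewrite mulr0 add0r. Qed.

Lemma Re_addc (a b : R[i]) : complex.Re (a + b) = complex.Re a + complex.Re b.
Proof. by case: a; case: b. Qed.

Lemma Im_addc (a b : R[i]) : complex.Im (a + b) = complex.Im a + complex.Im b.
Proof. by case: a; case: b. Qed.

Lemma Re_sum (I : Type) (s : seq I) (P : pred I) (h : I -> R[i]) :
  complex.Re (\sum_(i <- s | P i) h i) = \sum_(i <- s | P i) complex.Re (h i).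
Proof. by elim/big_ind2: _ => // a1 a2 b1 b2 <- <-; exact: Re_addc. Qed.

Lemma Im_sum (I : Type) (s : seq I) (P : pred I) (h : I -> R[i]) :
  complex.Im (\sum_(i <- s | P i) h i) = \sum_(i <- s | P i) complex.Im (h i).
Proof. by elim/big_ind2: _ => // a1 a2 b1 b2 <- <-; exact: Im_addc. Qed.

(** The left side is the derivative of the logarithm plus that of its truncated series; summing the
    finite geometric series leaves only the tail. *)
Lemma geometric_ray w t K : 1 - t%:C * w != 0 ->
  - w / (1 - t%:C * w) + \sum_(k < K) w ^+ k.+1 * (t ^+ k)%:C =
  - w * (t%:C * w) ^+ K / (1 - t%:C * w).
Proof.
move=> h.
have -> : \sum_(k < K) w ^+ k.+1 * (t ^+ k)%:C =
    w * \sum_(k < K) (t%:C * w) ^+ k.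
  rewrite mulr_sumr; apply: eq_bigr => k _.
  by rewrite exprS -mulrA exprMn rmorphXn /= [in RHS]mulrC (mulrC (w ^+ k)) [in RHS]mulrC.
have := subrX1 (t%:C * w) K; set S := \sum_(k < K) _ => E.
have E' : (1 - t%:C * w) * S = 1 - (t%:C * w) ^+ K.
  by apply: oppr_inj; rewrite -mulNr !opprB E.
have -> : S = (1 - (t%:C * w) ^+ K) / (1 - t%:C * w).
  by rewrite -E' mulrC mulKf.
by field.
Qed.

(* Mean value theorem for t |-> clog (1 - t w) + \sum_(k < K) (t w)^(k+1)/(k+1),
   whose derivative is - w (t w)^K / (1 - t w); the factor 2 comes from treating
   the real and imaginary parts separately. *)
Lemma clog_one_sub_remainder w K : normc w < 1 ->
  normc (clog (1 - w) + \sum_(k < K) w ^+ k.+1 / k.+1%:R) <=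
  2 * (normc w ^+ K.+1 / (1 - normc w)).
Proof.
move=> w1; set B := normc w ^+ K.+1 / _.
have r0 : 0 < 1 - normc w by rewrite subr_gt0.
have tw t : 0 <= t <= 1 -> normc (t%:C * w) <= normc w.
  move=> /andP[t0 t1].
  by rewrite Normc.normcM normc_real ger0_norm// ler_piMl// normc_ge0.
pose x := complex.Re w; pose y := complex.Im w.
have wE : w = x +i* y by case: (w) @x @y.
have xr t : 0 <= t <= 1 -> 0 < 1 - t * x.
  move=> /andP[t0 t1]; rewrite subr_gt0; apply: (le_lt_trans _ w1).
  apply: (le_trans _ (ler_piMl (normc_ge0 w) t1)).
  by rewrite ler_wpM2l// (le_trans (ler_norm _)) ?normcRe_le.
pose c k := complex.Re (w ^+ k.+1); pose d k := complex.Im (w ^+ k.+1).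
pose df t := - (x * (1 - t * x) - t * y ^+ 2) / ((1 - t * x) ^+ 2 + (t * y) ^+ 2) +
    \sum_(k < K) c k * t ^+ k.
pose dg t := - y / ((1 - t * x) ^+ 2 + (t * y) ^+ 2) + \sum_(k < K) d k * t ^+ k.
(* One complex bound controls both derivatives, from |t w| <= |w| and |1 - t w| >= 1 - |w|. *)
have dfg t : 0 <= t <= 1 -> normc (df t +i* dg t) <= B.
  move=> t01.
  have n0 : 1 - t%:C * w != 0.
    by apply: one_subr_neq0; apply: le_lt_trans (tw t t01) w1.
  have -> : df t +i* dg t = - w * (t%:C * w) ^+ K / (1 - t%:C * w).
    rewrite -geometric_ray//.
    have -> : - w / (1 - t%:C * w) =
        (- (x * (1 - t * x) - t * y ^+ 2) / ((1 - t * x) ^+ 2 + (t * y) ^+ 2))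
        +i* (- y / ((1 - t * x) ^+ 2 + (t * y) ^+ 2)).
      rewrite wE.
      have -> : 1 - t%:C * (x +i* y) = (1 - t * x) +i* (- (t * y)).
        by apply/eqP; rewrite eq_complex/= !mul0r !subr0 !addr0 !sub0r !eqxx.
      have D0 : (1 - t * x) ^+ 2 + (t * y) ^+ 2 != 0.
        by rewrite gt_eqF// ltr_wpDr ?sqr_ge0 ?exprn_gt0// xr.
      apply/eqP; rewrite eq_complex/= sqrrN.
      by apply/andP; split; apply/eqP; field.
    apply/eqP; rewrite eq_complex.
    rewrite Re_addc Im_addc Re_sum Im_sum /df /dg /= /c /d.
    by apply/andP; split; apply/eqP; congr (_ + _);
      apply: eq_bigr => k _; rewrite ?ReMr ?ImMr.
  rewrite Normc.normcM Normc.normcV Normc.normcM normc_oppr normcX.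
  rewrite /B exprS ler_pM ?invr_ge0 ?normc_ge0 ?mulr_ge0 ?exprn_ge0 ?normc_ge0//.
    by rewrite ler_wpM2l ?normc_ge0// lerXn2r ?nnegrE ?normc_ge0// tw.
  rewrite lef_pV2 ?posrE//.
    by apply: le_trans (normc_one_subr _); rewrite lerD2l lerN2 tw.
  by apply: lt_le_trans (normc_one_subr _); rewrite subr_gt0 (le_lt_trans (tw t t01)).
pose f s := ln ((1 - s * x) ^+ 2 + (- (s * y)) ^+ 2) / 2 +
  \sum_(k < K) c k / k.+1%:R * s ^+ k.+1.
pose g s := atan (- (s * y) / (1 - s * x)) +
  \sum_(k < K) d k / k.+1%:R * s ^+ k.+1.
have fB : `|f 1| <= B.
  apply: (@le_mean_value f df).
  - rewrite /f !mul0r subr0 oppr0 expr1n expr0n addr0 ln1 mul0r add0r.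
    by apply: big1 => k _; rewrite expr0n mulr0.
  - move=> t t01; exact: is_deriveD
      (is_derive_ln_ray _ (xr t t01)) (is_derive_trunc_pseries c K t).
  - by move=> t t01; apply: le_trans (dfg t t01); exact: (normcRe_le (_ +i* _)).
have gB : `|g 1| <= B.
  apply: (@le_mean_value g dg).
  - rewrite /g !mul0r oppr0 mul0r atan0 add0r.
    by apply: big1 => k _; rewrite expr0n mulr0.
  - move=> t t01; exact: is_deriveD
      (is_derive_atan_ray _ (xr t t01)) (is_derive_trunc_pseries d K t).
  - by move=> t t01; apply: le_trans (dfg t t01); exact: (normcIm_le (_ +i* _)).
have -> : clog (1 - w) + \sum_(k < K) w ^+ k.+1 / k.+1%:R = f 1 +i* g 1.
  have R1 : complex.Re (1 - w) = 1 - x by rewrite wE.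
  have I1 : complex.Im (1 - w) = - y by rewrite wE /= sub0r.
  have nE k : (k.+1%:R : R[i])^-1 = ((k.+1%:R)^-1 : R)%:C.
    by rewrite fmorphV /= rmorph_nat.
  rewrite clogE R1 ?I1; last by have := xr 1; rewrite ler01 lexx mul1r; apply.
  apply/eqP; rewrite eq_complex Re_addc Im_addc Re_sum Im_sum /= /f /g !mul1r.
  by apply/andP; split; apply/eqP; congr (_ + _); apply: eq_bigr => k _;
    rewrite nE expr1n mulr1 ?ReMr ?ImMr.
apply: (le_trans (normc_le_ReIm _)) => /=.
by rewrite mulr_natl mulr2n lerD.
Qed.

End LogSeries.

(** * Finite sums over coprime pairs *)

Lemma big_uniq_sub (V : nmodType) (T : eqType) (s s' : seq T) (P : pred T)
    (f : T -> V) : uniq s -> uniq s' -> {subset s <= s'} ->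
  \sum_(i <- s | P i) f i = \sum_(i <- s' | P i && (i \in s)) f i.
Proof.
move=> us us' ss.
rewrite [RHS](eq_bigl (fun i => (i \in s) && P i)); last by move=> i; apply: andbC.
rewrite -big_filter_cond; apply: perm_big; apply: uniq_perm => //.
  exact: filter_uniq.
move=> i; rewrite mem_filter. by case: (boolP (i \in s)) => [/ss ->|].
Qed.

(** A list of pairs of naturals, so that it can be compared with arbitrary finite index sets.
    Coordinates equal to 0 occur, but [coprime_pair] rejects them. *)
Definition box N : seq (nat * nat) :=
  [seq (val p.1, val p.2) | p <- enum {: 'I_N.+1 * 'I_N.+1}].

Lemma box_uniq N : uniq (box N).
Proof.
rewrite map_inj_uniq ?enum_uniq// => -[a b] [c d] /= [ac bd].
by congr pair; apply: val_inj.
Qed.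

Lemma mem_box N m n : ((m, n) \in box N) = (m <= N)%N && (n <= N)%N.
Proof.
apply/mapP/andP => [[[a b] _ [-> ->]]|[mN nN]].
  by split; rewrite -ltnS.
have mN' : (m < N.+1)%N by [].
have nN' : (n < N.+1)%N by [].
by exists (Ordinal mN', Ordinal nN'); rewrite // mem_enum.
Qed.

Lemma big_box (V : nmodType) (P : nat -> nat -> bool) (f : nat -> nat -> V) N :
  \sum_(p <- box N | P p.1 p.2) f p.1 p.2 =
  \sum_(n < N.+1) \sum_(m < N.+1 | P m n) f m n.
Proof.
rewrite big_map big_enum_cond /=.
rewrite -(pair_big_dep xpredT (fun m n : 'I_N.+1 => P m n) (fun m n => f m n)).
by rewrite (exchange_big_dep xpredT).
Qed.

(** The multiples of [n] up to [N] are n(k+1) with k < N/n, which matches the truncation of the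
    logarithm of 1 - z^n at order N/n. *)
Lemma sum_dvdn_multiples (V : nmodType) (f : nat -> V) n N : (0 < n)%N ->
  \sum_(1 <= M < N.+1 | (n %| M)%N) f M = \sum_(k < N %/ n) f (n * k.+1)%N.
Proof.
move=> n0; elim: N => [|N IH]; first by rewrite div0n big_ord0 big_geq.
rewrite big_mkcond big_nat_recr//= -big_mkcond IH divnS//.
case: ifPn => [dv|_]; last by rewrite addr0.
rewrite add1n big_ord_recr /=; congr (_ + f _).
by have := divnK dv; rewrite divnS// dv add1n mulnC => ->.
Qed.

(* The pair (m, n) corresponds to j = m (M / n), with inverse
   j |-> (j / gcd(j, M), M / gcd(j, M)). *)
Lemma sum_coprime_fractions (F : numFieldType) M N : (0 < M <= N)%N ->
  \sum_(p : 'I_N.+1 * 'I_N.+1 |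
      coprime_pair (val p.1, val p.2) && (p.2 %| M)%N) (p.1%:R / p.2%:R : F)
  = (M%:R + 1) / 2.
Proof.
move=> /andP[M0 MN].
have MF : M%:R != 0 :> F by rewrite pnatr_eq0 -lt0n.
pose h (j : 'I_M.+1) : 'I_N.+1 * 'I_N.+1 :=
  (inord (j %/ gcdn j M), inord (M %/ gcdn j M)).
pose h' (p : 'I_N.+1 * 'I_N.+1) : 'I_M.+1 := inord (p.1 * (M %/ p.2)).
(* [inord] is faithful here: both quotients are at most M <= N. *)
have hE (j : 'I_M.+1) : ((h j).1 = j %/ gcdn j M :> nat)%N /\
    ((h j).2 = M %/ gcdn j M :> nat)%N.
  rewrite /h /= !inordK// ltnS (leq_trans (leq_div _ _))//.
  by rewrite (leq_trans _ MN)// -ltnS.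
rewrite (reindex_onto h h'); last first.
  move=> [m n] /= /andP[/and4P[/= m0 n0 mn cop] dv].
  have E : (h' (m, n) = m * (M %/ n) :> nat)%N.
    rewrite /h' /= inordK// ltnS.
    by rewrite -[X in (_ <= X)%N](divnK dv) mulnC leq_mul2l mn orbT.
  have Mn0 : (0 < M %/ n)%N by rewrite divn_gt0// dvdn_leq.
  (* Coprimality of [m] and [n] makes M/n the gcd, so dividing by it returns [m] and [n]. *)
  have g : gcdn (h' (m, n)) M = (M %/ n)%N.
    by rewrite E -[X in gcdn _ X](divnK dv) [(m * _)%N]mulnC -muln_gcdr (eqP cop) muln1.
  have [h1 h2] := hE (h' (m, n)).
  congr pair; apply: val_inj; rewrite /= [LHS](h1, h2).
    by rewrite g E mulnK.
  by rewrite g -[X in (X %/ _)%N](divnK dv) mulKn.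
(* The index j = 0 drops out because [h] sends it to (0, 1), which is not a [coprime_pair]. *)
transitivity (\sum_(j < M.+1 | (0 < j)%N) (j%:R / M%:R : F)).
  have dj (j : 'I_M.+1) : (gcdn j M %| j)%N by apply: dvdn_gcdl.
  have dM (j : 'I_M.+1) : (gcdn j M %| M)%N by apply: dvdn_gcdr.
  have g0 (j : 'I_M.+1) : (0 < gcdn j M)%N by rewrite gcdn_gt0 M0 orbT.
  apply: eq_big => [j|j _].
    have [h1 h2] := hE j.
    have jM : (j <= M)%N by rewrite -ltnS.
    have -> : (h' (h j) == j).
      apply/eqP/val_inj; rewrite /h' h1 h2 /= inordK.
        rewrite -[X in (_ * (X %/ _))%N](divnK (dM j)) mulKn ?divnK//.
        by rewrite divn_gt0// dvdn_leq.
      rewrite -[X in (_ * (X %/ _))%N](divnK (dM j)) mulKn ?divnK//.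
      by rewrite divn_gt0// dvdn_leq.
    rewrite [\val (h j).1]h1 [\val (h j).2]h2 h2 /coprime_pair /= andbT !divn_gt0//.
    rewrite leq_div2r// (dvdn_leq M0 (dM j)) /=.
    have -> : coprime (j %/ gcdn j M) (M %/ gcdn j M).
      rewrite /coprime -(eqn_pmul2r (g0 j)) muln_gcdl !divnK// mul1n//.
    rewrite -[X in (_ %| X)%N](divnK (dM j)) dvdn_mulr// !andbT.
    case: posnP => [->|j0]; first by rewrite gcd0n leqNgt M0.
    by rewrite dvdn_leq.
  have [-> ->] := hE j.
  have gF : (gcdn j M)%:R != 0 :> F by rewrite pnatr_eq0 -lt0n.
  rewrite -[in RHS](divnK (dj j)) -[in X in _ = _ / X](divnK (dM j)) !natrM.
  rewrite invfM mulrACA divff// mulr1//.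
have gauss K : (\sum_(j < K.+1) (j%:R : F)) = K%:R * (K%:R + 1) / 2.
  elim: K => [|K IH]; first by rewrite big_ord1 !mul0r.
  by rewrite big_ord_recr /= IH -natr1; field.
rewrite -mulr_suml big_mkcond (eq_bigr (fun j : 'I_M.+1 => j%:R)).
  by rewrite gauss; field.
by move=> j _; case: posnP => [->|].
Qed.

(** At most [n] values of [m] occur, each with m/n^2 <= 1/n. *)
Lemma sum_coprime_weight_le1 (F : numFieldType) n A :
  \sum_(m < A | coprime_pair (val m, n)) (m%:R / n%:R ^+ 2 : F) <= 1.
Proof.
(* The bound [n] alone does not pass through the induction on [A]; the minimum does. *)
have cnt : (\sum_(m < A | 0 < m <= n) 1 <= minn A.-1 n)%N.
  elim: A => [|A IH]; first by rewrite big_ord0.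
  rewrite big_mkcond big_ord_recr -big_mkcond /=.
  by move: IH; set S := (\sum_(_ < _ | _) _)%N; case: ifP => /=; lia.
case: (posnP n) => [->|n0].
  by rewrite big1 ?ler01// => m /and4P[].
have nF : 0 < n%:R :> F by rewrite ltr0n.
apply: (@le_trans _ _ (\sum_(m < A | (0 < m <= n)%N) n%:R^-1)).
  rewrite big_mkcond [leRHS]big_mkcond; apply: ler_sum => m _.
  case: ifP => [/and4P[/= m0 _ mn _]|_]; last by case: ifP; rewrite // invr_ge0 ltW.
  by rewrite m0 mn expr2 invfM mulrA ler_piMl ?invr_ge0 ?ler0n//
    ler_pdivrMr// mul1r ler_nat.
rewrite (eq_bigr (fun=> 1%:R * n%:R^-1)); last by move=> m _; rewrite mul1r.
rewrite -mulr_suml -natr_sum ler_pdivrMr// mul1r ler_nat.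
by rewrite (leq_trans cnt)// geq_minr.
Qed.

(** Setting M = n(k+1) turns m/n^2 * 1/(k+1) into (m/n)/M. After exchanging the sums, x^M has
    coefficient (M+1)/(2M) = 1/2 + 1/(2M), whence the two series. *)
Lemma sum_coprime_powers (F : numFieldType) (x : F) N :
  \sum_(p <- box N | coprime_pair p)
     p.1%:R / p.2%:R ^+ 2 * \sum_(k < N %/ p.2) (x ^+ p.2) ^+ k.+1 / k.+1%:R
  = 2^-1 * \sum_(k < N) x ^+ k.+1 + 2^-1 * \sum_(k < N) x ^+ k.+1 / k.+1%:R.
Proof.
transitivity (\sum_(p <- box N | coprime_pair p)
    \sum_(1 <= M < N.+1 | (p.2 %| M)%N) (x ^+ M / M%:R) * (p.1%:R / p.2%:R)).
  apply: eq_bigr => -[m n] /= /and4P[/= m0 n0 _ _].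
  rewrite sum_dvdn_multiples// mulr_sumr; apply: eq_bigr => k _.
  rewrite -exprM natrM.
  by field; rewrite ?nat1r ?natr1 !pnatr_eq0 -lt0n n0.
rewrite (exchange_big_dep xpredT)//=.
transitivity (\sum_(1 <= M < N.+1) (x ^+ M / M%:R) * ((M%:R + 1) / 2)).
  rewrite big_nat [RHS]big_nat; apply: eq_bigr => M /andP[M0 MN].
  rewrite -mulr_sumr big_map big_enum_cond /=.
  by rewrite (@sum_coprime_fractions _ _ N)// M0.
rewrite big_add1 /= big_mkord !mulr_sumr -big_split; apply: eq_bigr => k _ /=.
by field; rewrite ?nat1r ?natr1 pnatr_eq0.
Qed.

(** * Error bounds for the weighted sums of logarithms *)

Section LogSum.
Variables (R : realType) (z : R[i]).
Local Notation normc := Normc.normc.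
Hypothesis z1 : normc z < 1.
Local Notation r := (normc z).
Local Notation Q N := (r ^+ N.+1 / (1 - r)).

Let weight p : R[i] := p.1%:R / p.2%:R ^+ 2.
Let logterm n := clog (1 - z ^+ n).

Let r0 : 0 <= r. Proof. exact: normc_ge0. Qed.
Let r1 : 0 < 1 - r. Proof. by rewrite subr_gt0. Qed.

Lemma normc_nat n : normc (n%:R : R[i]) = n%:R.
Proof. by rewrite -(rmorph_nat (@real_complex R)) normc_real ger0_norm. Qed.

Lemma normc_weight p : normc (weight p) = p.1%:R / p.2%:R ^+ 2.
Proof. by rewrite Normc.normcM Normc.normcV normcX !normc_nat. Qed.

(** Since |z|^n <= r, the denominator 1 - |z|^n can be replaced by 1 - r, uniformly in [n]. *)
Lemma logterm_remainder n K : (0 < n)%N ->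
  normc (logterm n + \sum_(k < K) (z ^+ n) ^+ k.+1 / k.+1%:R) <=
  2 * (r ^+ (n * K.+1) / (1 - r)).
Proof.
move=> n0.
have rn : r ^+ n <= r by rewrite -[leRHS]expr1 ler_wiXn2l// ltW.
have zn : normc (z ^+ n) < 1 by rewrite normcX (le_lt_trans rn).
apply: (le_trans (clog_one_sub_remainder K zn)).
rewrite normcX -exprM ler_pM2l// ler_wpM2l ?exprn_ge0//.
by rewrite lef_pV2 ?posrE ?lerD2l ?lerN2// subr_gt0 (le_lt_trans rn).
Qed.

(** Each of the N+1 values of [n] contributes total weight at most 1. *)
Lemma sum_normc_weight (c : R) N : 0 <= c ->
  \sum_(p <- box N | coprime_pair p) normc (weight p) * c <= N.+1%:R * c.
Proof.
move=> c0.
rewrite -mulr_suml ler_wpM2r//.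
rewrite (eq_bigr (fun p => p.1%:R / p.2%:R ^+ 2)); last first.
  by move=> p _; rewrite normc_weight.
rewrite (eq_bigl (fun p => coprime_pair (p.1, p.2))); last by case.
rewrite (big_box (fun m n => coprime_pair (m, n)) (fun m n => m%:R / n%:R ^+ 2 : R)).
apply: (@le_trans _ _ (\sum_(n < N.+1) 1)).
  by apply: ler_sum => n _; apply: sum_coprime_weight_le1.
by rewrite sumr_const card_ord.
Qed.

(** The error is at most 2(N+1)Q from the remainders in the box, Q/2 from the geometric tail and Q
    from the remainder of log(1 - z); 4(N+1)Q covers all three. *)
Lemma box_estimate N :
  normc (\sum_(p <- box N | coprime_pair p) weight p * logterm p.2 -
     (2^-1 * logterm 1 - 2^-1 * (z / (1 - z)))) <= 4 * N.+1%:R * Q N.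
Proof.
pose tr n := \sum_(k < N %/ n) (z ^+ n) ^+ k.+1 / k.+1%:R : R[i].
have Q0 : 0 <= Q N by rewrite divr_ge0 ?exprn_ge0// ltW.
(* Add and subtract the truncated series, whose weighted sum is known exactly. *)
have -> : \sum_(p <- box N | coprime_pair p) weight p * logterm p.2 =
   \sum_(p <- box N | coprime_pair p) weight p * (logterm p.2 + tr p.2)
   - (2^-1 * \sum_(k < N) z ^+ k.+1 + 2^-1 * \sum_(k < N) z ^+ k.+1 / k.+1%:R).
  rewrite -sum_coprime_powers.
  under [X in _ = X - _]eq_bigr do rewrite mulrDr.
  by rewrite big_split addrK.
set A := \sum_(p <- _ | _) _.
have -> : \sum_(k < N) z ^+ k.+1 = (z - z ^+ N.+1) / (1 - z).
  have z0 := one_subr_neq0 z1.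
  apply: (mulIf z0); rewrite divfK//.
  have -> : \sum_(k < N) z ^+ k.+1 = z * \sum_(k < N) z ^+ k.
    by rewrite mulr_sumr; apply: eq_bigr => k _; rewrite exprS.
  have /(congr1 (+%R^~ 1)) := subrX1 z N; rewrite subrK exprS => ->.
  by ring.
have B1 := @logterm_remainder 1 N isT; rewrite expr1 mul1n in B1.
set L := \sum_(k < N) _ in B1 *.
have AB : normc A <= N.+1%:R * (2 * Q N).
  apply: (le_trans (normc_sum _ _ _)).
  apply: le_trans (sum_normc_weight N _); last by rewrite mulr_ge0.
  rewrite big_seq_cond [leRHS]big_seq_cond; apply: ler_sum => -[m n] /=.
  move=> /andP[_ /and4P[/= _ n0 _ _]].
  rewrite Normc.normcM ler_wpM2l ?normc_ge0//.
  apply: (le_trans (logterm_remainder _ n0)).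
  rewrite ler_pM2l// ler_wpM2r ?invr_ge0 ?(ltW r1)//.
  (* The remainder has exponent n(floor(N/n) + 1), which exceeds N. *)
  rewrite ler_wiXn2l// ?(ltW z1)//.
  by rewrite mulnC ltn_ceil.
have -> : A - (2^-1 * ((z - z ^+ N.+1) / (1 - z)) + 2^-1 * L)
   - (2^-1 * logterm 1 - 2^-1 * (z / (1 - z)))
   = A + (2^-1 * (z ^+ N.+1 / (1 - z)) - 2^-1 * (logterm 1 + L)).
  by field; rewrite one_subr_neq0.
have half : normc (2^-1 : R[i]) = 2^-1 by rewrite Normc.normcV normc_nat.
have C1 : normc (2^-1 * (z ^+ N.+1 / (1 - z))) <= 2^-1 * Q N.
  rewrite !Normc.normcM half Normc.normcV normcX ler_pM2l ?invr_gt0//.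
  rewrite ler_wpM2l ?exprn_ge0// lef_pV2 ?posrE ?normc_one_subr//.
  exact: lt_le_trans (normc_one_subr _).
have C2 : normc (- (2^-1 * (logterm 1 + L))) <= Q N.
  rewrite normc_oppr Normc.normcM half.
  by rewrite -[leRHS](mulKf (x := 2)) ?ler_pM2l ?invr_gt0// pnatr_eq0.
have N1 : 1 <= N.+1%:R :> R by rewrite ler1n.
apply: (le_trans (normc_addr _ _)).
apply: (le_trans (lerD AB (le_trans (normc_addr _ _) (lerD C1 C2)))).
nra.
Qed.

(** Each [n] has total weight at most 1 and a logarithm of size O(r^n), so a geometric tail bounds
    the sum independently of [F]. *)
Lemma tail_estimate N (F : seq (nat * nat)) : uniq F ->
  normc (\sum_(p <- F | coprime_pair p && (N < p.2)%N) weight p * logterm p.2)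
  <= 2 / (1 - r) * Q N.
Proof.
move=> uF.
(* The box of size [A] contains [F]; the final bound does not depend on [A]. *)
pose A := \max_(p <- F) maxn p.1 p.2.
have FA : {subset F <= box A}.
  move=> [m n] mnF; rewrite mem_box -geq_max /A.
  by rewrite (big_rem _ mnF) /= leq_maxl.
pose g p := normc (weight p) * (2 * (r ^+ p.2 / (1 - r))).
have g0 p : 0 <= g p.
  by rewrite /g !mulr_ge0 ?normc_ge0 ?exprn_ge0 ?invr_ge0 ?(ltW r1).
apply: (le_trans (normc_sum _ _ _)).
apply: (@le_trans _ _ (\sum_(p <- F | coprime_pair p && (N < p.2)%N) g p)).
  apply: ler_sum => -[m n] /= /andP[/and4P[/= _ n0 _ _] _].
  rewrite Normc.normcM ler_wpM2l ?normc_ge0//.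
  (* Truncation at order 0 bounds the logarithm itself. *)
  have := logterm_remainder 0 n0; rewrite big_ord0 addr0 muln1; exact.
rewrite (big_uniq_sub _ _ uF (box_uniq A) FA).
apply: (@le_trans _ _ (\sum_(p <- box A | coprime_pair p && (N < p.2)%N) g p)).
  by rewrite big_mkcondr /=; apply: ler_sum => p _; case: ifP.
rewrite (eq_bigl (fun p => coprime_pair (p.1, p.2) && (N < p.2)%N)); last by case.
rewrite (eq_bigr (fun p => g (p.1, p.2))); last by case.
rewrite (big_box (fun m n => coprime_pair (m, n) && (N < n)%N) (fun m n => g (m, n))).
apply: (@le_trans _ _ (\sum_(n < A.+1 | (N < n)%N) 2 * (r ^+ n / (1 - r)))).
  rewrite [leRHS]big_mkcond; apply: ler_sum => n _.
  case: ifP => Nn; last by rewrite big_pred0// => m; rewrite andbF.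
  under eq_bigl do rewrite andbT.
  rewrite /g /= -mulr_suml.
  rewrite ler_piMl ?mulr_ge0 ?exprn_ge0 ?invr_ge0 ?(ltW r1)//.
  under eq_bigr do rewrite normc_weight /=.
  exact: sum_coprime_weight_le1.
rewrite -mulr_sumr -mulr_suml.
suff h : \sum_(n < A.+1 | (N < n)%N) r ^+ n <= Q N.
  rewrite -[leRHS]mulrA [_^-1 * Q N]mulrC ler_wpM2l//.
  by rewrite ler_wpM2r ?invr_ge0 ?(ltW r1).
rewrite ler_pdivlMr//.
rewrite -(big_geq_mkord N.+1 A.+1 xpredT (fun n => r ^+ n)).
rewrite -{1}[N.+1]add0n big_addn big_mkord.
under eq_bigr do rewrite exprD.
rewrite -mulr_suml mulrAC ler_piMl ?exprn_ge0//.
set K := (_ - _)%N; have := subrX1 r K; set S := \sum_(_ < _) _ => E.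
have -> : S * (1 - r) = 1 - r ^+ K by rewrite -(opprB (r ^+ K)) E; ring.
by rewrite gerBl exprn_ge0.
Qed.

End LogSum.

(** * Complex exponential *)

Section Cexp.
Variable R : realType.
Implicit Types u v : R[i].
Local Notation normc := Normc.normc.

Lemma cexpD u v : cexp (u + v) = cexp u * cexp v.
Proof.
case: u v => [a b] [c d]; rewrite /cexp /= expRD cosD sinD.
by apply/eqP; rewrite eq_complex/=; apply/andP; split; apply/eqP; ring.
Qed.

Lemma cexp0 : cexp 0 = 1 :> R[i].
Proof. by rewrite /cexp /= expR0 cos0 sin0 mul1r. Qed.

Lemma cexp_sum (I : Type) (s : seq I) (P : pred I) (f : I -> R[i]) :
  cexp (\sum_(i <- s | P i) f i) = \prod_(i <- s | P i) cexp (f i).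
Proof. exact: (big_morph _ cexpD cexp0). Qed.

(** Continuity at 0 is enough, because the addition formula carries it to every other point. *)
Lemma cexp_near0 (e : R) : 0 < e ->
  exists2 d, 0 < d & forall u, normc u < d -> normc (cexp u - 1) < e.
Proof.
(* The real part of [cexp u - 1] costs two quarters of [e]; the imaginary part costs 2 * (e/4), the
   factor 2 bounding [expR]. *)
move=> e0; have e4 : 0 < e / 4 by rewrite divr_gt0.
have nE : \forall x \near (0 : R), `|expR x - 1| < e / 4.
  have := @continuous_expR R 0; rewrite /continuous_at expR0 => /cvgrPdist_lt/(_ _ e4).
  by apply: filterS => x; rewrite distrC.
have nC : \forall x \near (0 : R), `|cos x - 1| < e / 4.
  have := @continuous_cos R 0; rewrite /continuous_at cos0 => /cvgrPdist_lt/(_ _ e4).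
  by apply: filterS => x; rewrite distrC.
have nS : \forall x \near (0 : R), `|sin x| < e / 4.
  have := @continuous_sin R 0; rewrite /continuous_at sin0 => /cvgrPdist_lt/(_ _ e4).
  by apply: filterS => x; rewrite sub0r normrN.
have nb : \forall x \near (0 : R), expR x < 2.
  have := @continuous_expR R 0; rewrite /continuous_at expR0 => /cvgrPdist_lt/(_ _ ltr01).
  by apply: filterS => x; rewrite ltr_norml => /andP[? ?]; lra.
have := filterI (filterI nE nC) (filterI nS nb).
rewrite nbhs_ballP => -[d /= d0 dH].
exists d => // u ud.
have xd : ball 0 d (complex.Re u).
  by rewrite /ball/= sub0r normrN; apply: le_lt_trans ud; apply: normcRe_le.
have yd : ball 0 d (complex.Im u).
  by rewrite /ball/= sub0r normrN; apply: le_lt_trans ud; apply: normcIm_le.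
have [[Ex _] [_ x2]] := dH _ xd; have [[_ Cy] [Sy _]] := dH _ yd.
apply: (le_lt_trans (normc_le_ReIm (cexp u - 1))).
move: Ex Cy Sy x2 (cos_max (complex.Im u)) (expR_gt0 (complex.Re u)).
case: u {ud xd yd} => a b; rewrite /= !mul0r subr0 addr0 oppr0 addr0 => Ex Cy Sy x2 c1 x0.
have -> : expR a * cos b - 1 = (expR a - 1) * cos b + (cos b - 1) by ring.
have h1 : `|(expR a - 1) * cos b + (cos b - 1)| < e / 4 + e / 4.
  apply: (le_lt_trans (ler_normD _ _)); rewrite ltr_leD ?(ltW Cy)// normrM.
  by apply: le_lt_trans Ex; rewrite ler_piMr.
have h2 : `|expR a * sin b| < 2 * (e / 4).
  by rewrite normrM ltr_pM// gtr0_norm.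
by apply: lt_le_trans (ltrD h1 h2) _; lra.
Qed.

End Cexp.

(* Bernoulli's inequality for q = sqrt r gives n q^n <= 1 / (1 - q), hence
   n r^n <= q^n / (1 - q). *)
Lemma exists_small_mul_expr (R : realType) (r e : R) : 0 <= r < 1 -> 0 < e ->
  exists N, N.+1%:R * r ^+ N.+1 < e.
Proof.
move=> /andP[r0 r1] e0; pose q := Num.sqrt r.
have q0 : 0 <= q by exact: sqrtr_ge0.
have rE : r = q * q by rewrite -expr2 sqr_sqrtr.
have q1 : q < 1 by rewrite -sqrtr1 ltr_sqrt.
have bern n : n%:R * q ^+ n * (1 - q) <= 1 - q ^+ n.
  elim: n => [|n IH]; first by rewrite !mul0r expr0 subrr.
  have qn1 : q ^+ n.+1 <= 1 by rewrite exprn_ile1// ltW.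
  move: IH qn1; rewrite -natr1 !exprS; set Q := q ^+ n; set m := n%:R.
  have : 0 <= Q by rewrite exprn_ge0.
  move=> Q0 IH qn1.
  (* The induction step is [h1] plus qQ(1 - q) on both sides; the slack left over is exactly the
     product in [h2]. *)
  have h1 : q * (m * Q * (1 - q)) <= q * (1 - Q) by rewrite ler_wpM2l.
  have h2 : 0 <= (1 - q) * (1 - q * Q) by rewrite mulr_ge0 ?subr_ge0// ltW.
  by nra.
have := @cvg_geometric R 1 q; rewrite ger0_norm// => /(_ q1) /cvgrPdist_lt.
have d0 : 0 < e * (1 - q) by rewrite mulr_gt0 ?subr_gt0.
move=> /(_ _ d0) [N _ /(_ N.+1 (leqnSn N))].
rewrite /= sub0r normrN mul1r ger0_norm ?exprn_ge0// => h.
exists N; rewrite rE exprMn mulrA.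
rewrite -(ltr_pM2r (x := 1 - q)) ?subr_gt0//.
apply: le_lt_trans h; rewrite mulrAC ler_piMl ?exprn_ge0//.
by apply: (le_trans (bern _)); rewrite gerBl exprn_ge0.
Qed.

(** * Unconditional convergence, from logarithms to products *)

Section Product.
Variables (R : realType) (z : R[i]).
Local Notation normc := Normc.normc.
Hypothesis z1 : normc z < 1.

(** Places every base in the half-plane where [clogV] applies. *)
Lemma one_subX_Re_gt0 n : (0 < n)%N -> 0 < complex.Re (1 - z ^+ n).
Proof.
move=> n0; rewrite Re_addc.
have -> : complex.Re (- z ^+ n) = - complex.Re (z ^+ n) by case: (z ^+ n).
rewrite subr_gt0 (le_lt_trans (ler_norm _))// (le_lt_trans (normcRe_le _))//.
by rewrite normcX exprn_ilt1// ?normc_ge0// -lt0n.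
Qed.

Lemma coprime_log_sum_cvg (e : R) : 0 < e ->
  \forall F \near (@totally (nat * nat)%type : set_system {fset _}),
  normc (\sum_(p <- (F : {fset _}) | coprime_pair p)
    p.1%:R / p.2%:R ^+ 2 * clog (1 - z ^+ p.2)
    - (2^-1 * clog (1 - z ^+ 1) - 2^-1 * (z / (1 - z)))) < e.
Proof.
move=> e0.
have r0 := normc_ge0 z; have r1 : 0 < 1 - normc z by rewrite subr_gt0.
(* The box and tail bounds add up to at most C(N+1)r^(N+1) with r = |z|, because N+1 >= 1. *)
pose C := (4 + 2 / (1 - normc z)) / (1 - normc z).
have C0 : 0 < C by rewrite divr_gt0// addr_gt0// divr_gt0.
have [|N hN] := @exists_small_mul_expr R (normc z) (e / C) _ (divr_gt0 e0 C0).
  by rewrite r0.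
exists [fset p in box N]%fset => // F /= /fsubsetP bF.
have bF' : {subset box N <= F} by move=> p pb; apply: bF; rewrite inE.
rewrite (bigID (fun p => p.2 <= N)%N) /=.
(* As m <= n, the condition n <= N already puts a pair in the box, and the box lies inside [F]. *)
have -> : \sum_(p <- F | coprime_pair p && (p.2 <= N)%N)
      p.1%:R / p.2%:R ^+ 2 * clog (1 - z ^+ p.2) =
    \sum_(p <- box N | coprime_pair p) p.1%:R / p.2%:R ^+ 2 * clog (1 - z ^+ p.2).
  rewrite (big_uniq_sub _ _ (box_uniq N) (fset_uniq F) bF').
  apply: eq_bigl => -[m n]; rewrite mem_box.
  case: (boolP (coprime_pair _)) => //= /and4P[/= _ _ mn _].
  by case: leqP => nN; rewrite ?andbF ?andbT// (leq_trans mn).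
under [X in _ + X - _]eq_bigl do rewrite -ltnNge.
rewrite addrAC; apply: (le_lt_trans (normc_addr _ _)).
apply: (le_lt_trans (lerD (box_estimate z1 N) (tail_estimate z1 N (fset_uniq F)))).
have -> : 4 * N.+1%:R * (normc z ^+ N.+1 / (1 - normc z)) +
     2 / (1 - normc z) * (normc z ^+ N.+1 / (1 - normc z)) =
   (4 * N.+1%:R + 2 / (1 - normc z)) / (1 - normc z) * normc z ^+ N.+1.
  by ring.
apply: (@le_lt_trans _ _ (C * (N.+1%:R * normc z ^+ N.+1))); last first.
  by rewrite mulrC -ltr_pdivlMr.
rewrite mulrA ler_wpM2r ?exprn_ge0// /C -mulrA [_^-1 * N.+1%:R]mulrC mulrA.
rewrite ler_wpM2r ?invr_ge0 ?(ltW r1)//.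
have D0 : 0 <= 2 / (1 - normc z) by rewrite divr_ge0// ltW.
have N1 : 1 <= N.+1%:R :> R by rewrite ler1n.
by rewrite [leRHS]mulrDl lerD2l ler_peMr.
Qed.

(** By the addition formula, exp(S) - exp(l) = exp(l)(exp(S - l) - 1), where S - l is small. *)
Lemma prod_cvg_cexp (f : nat * nat -> R[i]) (l : R[i]) :
  (forall e : R, 0 < e ->
    \forall F \near (@totally (nat * nat)%type : set_system {fset _}),
    normc (\sum_(p <- (F : {fset _}) | coprime_pair p) f p - l) < e) ->
  prod_cvg coprime_pair (fun p => cexp (f p)) (cexp l).
Proof.
move=> h; apply/cvgrPdist_lt => eps; case: eps => e e'.
(* The norm on [R[i]] is complex-valued, hence so is the tolerance; being positive, it has zero
   imaginary part. *)
rewrite ltcE /= => /andP[/eqP -> e0].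
(* Adding 1 gives a positive divisor without showing that [cexp l] is nonzero. *)
have l0 : 0 < normc (cexp l) + 1 by rewrite ltr_wpDl ?normc_ge0.
have [d d0 dH] := cexp_near0 (divr_gt0 e0 l0).
apply: filterS (h d d0) => F Fd.
rewrite -cexp_sum distrC normcrE ltcR.
have -> : cexp (\sum_(p <- F | coprime_pair p) f p) - cexp l =
    cexp l * (cexp (\sum_(p <- F | coprime_pair p) f p - l) - 1).
  by rewrite mulrBr mulr1 -cexpD [l + _]addrC subrK.
rewrite Normc.normcM; have := dH _ Fd; rewrite ltr_pdivlMr//.
apply: le_lt_trans; rewrite mulrC ler_wpM2l ?normc_ge0// lerDl//.
Qed.

End Product.

Theorem theorem23 (R : realType) (z : R[i]) (hz : `|z| < 1) :
  prod_cvg coprime_pair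
    (fun p => cpow (1 / (1 - z ^+ p.2)) (p.1%:R / p.2%:R ^+ 2))
    (csqrt (1 / (1 - z)) * cexp (1 / 2 * (z / (1 - z))))
  /\
  prod_cvg coprime_pair
    (fun p => cpow (1 - z ^+ p.2) (p.1%:R / p.2%:R ^+ 2))
    (csqrt (1 - z) * cexp (- (1 / 2 * (z / (1 - z))))).
Proof.
have z1 : Normc.normc z < 1.
  by move: hz; rewrite normcrE -(rmorph1 (@real_complex R)) ltcR.
have re n : (0 < n)%N -> 0 < complex.Re (1 - z ^+ n) by exact: one_subX_Re_gt0.
have re1 : 0 < complex.Re (1 - z) by rewrite -[z]expr1 re.
(* Each limit becomes a single [cexp], and the two exponents are opposite by [clogV]. *)
rewrite /csqrt /cpow -!cexpD [1 / 2]div1r clogV//; split; last first.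
  apply: prod_cvg_cexp => e e0.
  by have := coprime_log_sum_cvg z1 e0; rewrite expr1.
apply: prod_cvg_cexp => e e0.
apply: filterS (coprime_log_sum_cvg z1 e0) => F; rewrite expr1.
(* The first product follows from the same estimate after a change of sign inside the modulus. *)
rewrite -normc_oppr opprD opprK -sumrN => /(le_lt_trans _); apply.
rewrite le_eqVlt; apply/orP; left; apply/eqP; congr Normc.normc.
rewrite opprD mulrN opprK; congr (_ + _).
by apply: eq_bigr => p /and4P[_ n0 _ _]; rewrite clogV ?re// mulrN.
Qed.
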